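(* For all integers $n\ge 1$, $r\ge 1$, $\ell\ge 0$ and all positive real numbers $x_1,\ldots,x_r$, $$\frac{1}{|\mathcal{K}_{n,r}|}\cdot\Big(\sum_{\underline{k}\in\mathcal{K}_{n,r}}\underline{y}_{\underline{k},\ell}\Big)\cdot\Big(\sum_{\underline{k}\in\mathcal{K}_{n,r}}\underline{x}^{\underline{k}}\Big)\ \ge\ \sum_{\underline{k}\in\mathcal{K}_{n,r}}\underline{y}_{\underline{k},\ell}\cdot\underline{x}^{\underline{k}}.$$
   Context: $\mathcal{K}_{n,r}:=\{\underline{k}=(k_1,\ldots,k_r)\in\mathbb{Z}^r : k_i\ge 0 \text{ for all } i,\ \sum_i k_i=n\}$. For $\underline{k}\in\mathcal{K}_{n,r}$: $\underline{y}_{\underline{k},\ell}:=\prod_{i=1}^r\frac{1}{(k_i+\ell)!}$ (with $0!=1$) and $\underline{x}^{\underline{k}}:=x_1^{k_1}\cdots x_r^{k_r}$. *)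

(* Defs.v *)
From mathcomp Require Import all_boot all_order all_algebra reals.
Set Implicit Arguments.
Unset Strict Implicit.
Unset Printing Implicit Defensive.
Import Order.TTheory GRing.Theory Num.Theory.
Local Open Scope ring_scope.

(* Each part of a composition of n into r nonnegative parts is at most n, so
   these compositions are exactly the maps 'I_r -> 'I_n.+1 with sum n. *)
Definition compositions (n r : nat) : {set {ffun 'I_r -> 'I_n.+1}} :=
  [set k : {ffun 'I_r -> 'I_n.+1} | (\sum_(i < r) k i)%N == n].

Definition y_coef (R : realType) (n r l : nat) (k : {ffun 'I_r -> 'I_n.+1}) : R :=
  \prod_(i < r) (1 / ((k i + l)`!)%:R).

Definition x_monomial (R : realType) (n r : nat) (x : 'I_r -> R)
    (k : {ffun 'I_r -> 'I_n.+1}) : R :=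
  \prod_(i < r) x i ^+ k i.

(* Main.v *)
Require Import Defs.
From mathcomp Require Import all_boot all_order all_algebra reals.
From mathcomp Require Import ring lra zify.
From mathcomp Require Import polyrcf.
From mathcomp Require Import boolp classical_sets topology normedtype derive realfun.
Set Implicit Arguments.
Unset Strict Implicit.
Unset Printing Implicit Defensive.
Import Order.TTheory GRing.Theory Num.Theory.
Import numFieldNormedType.Exports.
Local Open Scope ring_scope.

(** The coefficients are products y_k = prod_i w (k i) of a log-concave sequence
w, and that is all that matters. Let c be the mean of the y_k, and let
D(x) = sum_k (c - y_k) x^k be the [defect]; the claim is D >= 0 on nonnegative
vectors.

Fix two coordinates p <> q, put a = x p and b = x q, and group the compositions
by the values outside p and q, hence by m = k p + k q. Along such a class y_k is
largest for balanced splits of m, while the symmetrized monomials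
a^j b^(m-j) + a^(m-j) b^j are smallest there. So, by Chebyshev's sum inequality,
replacing every monomial by its average over the class can only decrease D
([defect_ge_smoothed]). That average is an integral of monomials:
  1/(m+1) sum_j a^j b^(m-j) = 1/(a-b) int_b^a s^m ds,
so the smoothed defect is the mean, for s between a and b, of the defect at the
vector obtained from x by setting both coordinates p and q to s.

Now let x minimize D over a cube [0, M]^r. The mean of these values is at most
D(x) and none of them is below D(x), so the polynomial
s |-> D(x with x p = x q = s) is constantly D(x); at s = b this says that
replacing x p by x q yields another minimizer ([merge_minimizer]). Repeating this
for every p leads to a constant vector ([defect_min_const]), where D vanishes by
the choice of c ([defect_const]). Hence the minimum of D over any cube is 0. *)

(** * Chebyshev's inequality on the splittings of an integer *)

Lemma rev_sum (V : nmodType) m (f : nat -> V) :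
  \sum_(j < m.+1) f (m - j)%N = \sum_(j < m.+1) f j.
Proof.
rewrite [RHS](reindex_inj rev_ord_inj) /=.
by apply: eq_bigr => j _; rewrite subSS.
Qed.

(** Chebyshev's sum inequality for oppositely ordered sequences. Only the
symmetric part of [v] under j |-> m - j matters, since [u] is symmetric; so both
monotonicity assumptions concern the left half of the range, and [v] enters
through v j + v (m - j). *)
Lemma chebyshev_sym (R : realFieldType) m (u v : nat -> R) :
    (forall j, (j <= m)%N -> u (m - j)%N = u j) ->
    (forall i j, (i <= j)%N -> (j <= m - j)%N -> u i <= u j) ->
    (forall i j, (i <= j)%N -> (j <= m - j)%N ->
       v j + v (m - j)%N <= v i + v (m - i)%N) ->
  m.+1%:R * (\sum_(j < m.+1) u j * v j) <=
  (\sum_(j < m.+1) u j) * (\sum_(j < m.+1) v j).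
Proof.
move=> u_sym u_mono v_mono.
pose t j := v j + v (m - j)%N.
have t_sym j : (j <= m)%N -> t (m - j)%N = t j.
  by move=> jm; rewrite /t subKn // addrC.
(* Reflecting each index into the left half and then ordering the two. *)
have fold_half (P : nat -> nat -> Prop) :
    (forall i j, (i <= m)%N -> (j <= m)%N -> P i j -> P j i) ->
    (forall i j, (i <= m)%N -> (j <= m)%N -> P i (m - j)%N -> P i j) ->
    (forall i j, (i <= j)%N -> (j <= m - j)%N -> P i j) ->
    forall i j, (i <= m)%N -> (j <= m)%N -> P i j.
  move=> Psym Prefl Pbase.
  have Phalf i j : (i <= m - i)%N -> (j <= m - j)%N -> P i j.
    case: (leqP i j) => ij im jm; first exact: Pbase.
    by apply: Psym; [lia|lia|apply: Pbase => //; lia].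
  have Pright i j : (i <= m - i)%N -> (j <= m)%N -> P i j.
    move=> im jm; case: (leqP j (m - j)) => jj; first exact: Phalf.
    by apply: Prefl => //; [lia|apply: Phalf => //; lia].
  move=> i j im jm; case: (leqP i (m - i)) => ii; first exact: Pright.
  apply: (Psym) => //; apply: Prefl => //; apply: (Psym) => //; first lia.
  by apply: Pright => //; lia.
have opp_mono i j : (i <= m)%N -> (j <= m)%N -> (u i - u j) * (t i - t j) <= 0.
  move: i j; apply: fold_half => [i j _ _|i j im jm|i j ij jm].
  - by apply: le_trans; rewrite le_eqVlt; apply/orP; left; apply/eqP; ring.
  - by rewrite u_sym // t_sym.
  - have := u_mono _ _ ij jm; have := v_mono _ _ ij jm.
    by rewrite -/(t i) -/(t j) => h1 h2; rewrite mulr_le0_ge0 // ?subr_le0 ?subr_ge0.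
(* The double sum is 2 ((m + 1) sum u t - (sum u) (sum t)), and both terms are
   twice what they are with v in place of t. *)
have le0 : \sum_(i < m.+1) \sum_(j < m.+1) (u i - u j) * (t i - t j) <= 0.
  apply: sumr_le0 => i _; apply: sumr_le0 => j _.
  by apply: opp_mono; rewrite -ltnS.
have utE : \sum_(j < m.+1) u j * t j = 2 * \sum_(j < m.+1) u j * v j.
  rewrite mulr_natl mulr2n -{2}(rev_sum _ (fun j => u j * v j)) -big_split /=.
  by apply: eq_bigr => j _; rewrite /t mulrDr u_sym // -ltnS.
have tE : \sum_(j < m.+1) t j = 2 * \sum_(j < m.+1) v j.
  by rewrite mulr_natl mulr2n -{2}(rev_sum _ v) -big_split.
have expand : \sum_(i < m.+1) \sum_(j < m.+1) (u i - u j) * (t i - t j) =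
    2 * (m.+1%:R * (\sum_(j < m.+1) u j * t j)
         - (\sum_(j < m.+1) u j) * (\sum_(j < m.+1) t j)).
  rewrite (eq_bigr (fun i : 'I_m.+1 => m.+1%:R * (u i * t i)
     - u i * (\sum_(j < m.+1) t j) - t i * (\sum_(j < m.+1) u j)
     + \sum_(j < m.+1) u j * t j)); last first.
    move=> i _; rewrite (eq_bigr (fun j : 'I_m.+1 => u i * t i
       - u i * t j - t i * u j + u j * t j)); last by move=> j _; ring.
    by rewrite big_split !sumrB /= -!mulr_sumr sumr_const card_ord mulr_natl -mulrnAr.
  rewrite big_split !sumrB /= -!mulr_suml -mulr_sumr sumr_const card_ord -[_ *+ _]mulr_natl.
  ring.
by move: le0; rewrite expand utE tE; lra.
Qed.

(** For positive [w] this is the usual condition w_i w_(i+2) <= w_(i+1)^2,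
i.e. the ratios w_(i+1) / w_i decrease; stated for all i <= j it also excludes
internal zeros when [w] is only nonnegative. *)
Definition logconcave (R : realFieldType) (w : nat -> R) :=
  forall i j, (i <= j)%N -> w i * w j.+1 <= w i.+1 * w j.

Lemma logconcave_prod_mono (R : realFieldType) (w : nat -> R) m i j :
    logconcave w -> (i <= j)%N -> (j <= m - j)%N ->
  w i * w (m - i)%N <= w j * w (m - j)%N.
Proof.
move=> w_lc; elim: j => [|j IHj]; first by rewrite leqn0 => /eqP->.
rewrite leq_eqVlt => /orP[/eqP-> //|]; rewrite ltnS => ij jm.
apply: le_trans (IHj ij _) _; first lia.
have -> : (m - j = (m - j.+1).+1)%N by lia.
by apply: w_lc; lia.
Qed.

(** With i + d = j and e = m - j - i, the difference of the two sides is
(ab)^i (a^d - b^d) (a^e - b^e), whose last two factors have the same sign. *)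
Lemma pair_power_mono (R : realFieldType) (a b : R) m i j :
    0 <= a -> 0 <= b -> (i <= j)%N -> (j <= m - j)%N ->
  a ^+ j * b ^+ (m - j) + a ^+ (m - j) * b ^+ (m - (m - j)) <=
  a ^+ i * b ^+ (m - i) + a ^+ (m - i) * b ^+ (m - (m - i)).
Proof.
move=> a0 b0 ij jm.
pose d := (j - i)%N; pose e := (m - j - i)%N.
have -> : (m - (m - j) = i + d)%N by rewrite /d; lia.
have -> : (m - (m - i) = i)%N by lia.
have -> : (m - i = i + d + e)%N by rewrite /d /e; lia.
have -> : (m - j = i + e)%N by rewrite /e; lia.
have -> : (j = i + d)%N by rewrite /d; lia.
rewrite -subr_ge0 !exprD.
rewrite [X in 0 <= X](_ : _ = (a ^+ i * b ^+ i) * ((a ^+ d - b ^+ d) * (a ^+ e - b ^+ e)));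
  last by ring.
apply: mulr_ge0; first by rewrite mulr_ge0 ?exprn_ge0.
have [ab|/ltW ba] := leP a b.
  by rewrite mulr_le0 // subr_le0 lerXn2r.
by rewrite mulr_ge0 // subr_ge0 lerXn2r.
Qed.

Lemma split_chebyshev (R : realFieldType) (w : nat -> R) (a b : R) m :
    logconcave w -> 0 <= a -> 0 <= b ->
  m.+1%:R * (\sum_(j < m.+1) (w j * w (m - j)%N) * (a ^+ j * b ^+ (m - j))) <=
  (\sum_(j < m.+1) w j * w (m - j)%N) * (\sum_(j < m.+1) a ^+ j * b ^+ (m - j)).
Proof.
move=> w_lc a0 b0.
apply: (@chebyshev_sym _ m (fun j => w j * w (m - j)%N) (fun j => a ^+ j * b ^+ (m - j))).
- by move=> j jm; rewrite subKn // mulrC.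
- by move=> i j; exact: logconcave_prod_mono.
- by move=> i j; exact: pair_power_mono.
Qed.

(** A polynomial, given by a primitive [P], that is at least [c] on an interval
and has mean at most [c] there is constant: P - c X is nondecreasing on the
interval and does not increase from [lo] to [hi], so it is constant there, hence
everywhere because a nonzero polynomial has finitely many roots. *)
Lemma poly_eq_of_mean_le (R : rcfType) (P : {poly R}) (c lo hi : R) :
    lo < hi -> (forall s, lo <= s <= hi -> c <= (P^`()).[s]) ->
    P.[hi] - P.[lo] <= c * (hi - lo) ->
  P^`() = c%:P.
Proof.
move=> lohi c_le mean_le.
pose Q := P - c *: 'X.
have Q' : Q^`() = P^`() - c%:P by rewrite derivB derivZ derivX alg_polyC.
have Q_const s : lo <= s <= hi -> Q.[s] = Q.[lo].
  move=> /andP[los shi].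
  have Q'_ge0 a b : lo <= a -> b <= hi -> forall y, y \in `]a, b[ -> 0 <= Q^`().[y].
    move=> loa bhi y /itvP yab; rewrite Q' hornerD hornerN hornerC subr_ge0 c_le //.
    by rewrite (le_trans loa) ?yab //= (le_trans _ bhi) ?yab.
  have h1 : Q.[lo] <= Q.[s].
    by apply: (ler_hornerW (Q'_ge0 lo s (lexx _) shi)); rewrite ?in_itv /= ?los ?lexx.
  have h2 : Q.[s] <= Q.[hi].
    by apply: (ler_hornerW (Q'_ge0 s hi los (lexx _))); rewrite ?in_itv /= ?lexx ?shi.
  have h3 : Q.[hi] <= Q.[lo] by rewrite /Q !hornerE; lra.
  by apply/le_anti; rewrite h1 (le_trans h2 h3).
suff Q0 : Q - Q.[lo]%:P = 0.
  have := congr1 (@deriv R) Q0; rewrite derivB derivC subr0 Q' deriv0.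
  by move/eqP; rewrite subr_eq0 => /eqP.
set D := Q - _; apply/eqP; apply: contraTT isT => D_neq0.
(* The points f i are infinitely many roots of D in the interval. *)
pose f i : R := lo + (hi - lo) / i.+1%:R.
pose rs := map f (iota 0 (size D)).
have f_inj : injective f.
  move=> i j /addrI /(mulfI _) h; have {}h := h (lt0r_neq0 _); move: h.
  rewrite subr_gt0 => /(_ lohi) /invr_inj /eqP.
  by rewrite eqr_nat eqSS => /eqP.
have := @max_poly_roots _ D rs D_neq0.
rewrite map_inj_uniq // iota_uniq size_map size_iota ltnn => h; apply/h => //.
apply/allP => _ /mapP[i _ ->]; rewrite /root /D hornerD hornerN hornerC Q_const ?subrr //.
have hl : 0 < hi - lo by rewrite subr_gt0.
have [h0 h1] : 0 <= (hi - lo) / i.+1%:R /\ (hi - lo) / i.+1%:R <= hi - lo.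
  by rewrite divr_ge0 ?(ltW hl) // ler_pdivrMr // ler_peMr ?(ltW hl) // ler1n.
rewrite /f; move: h0 h1; move: (_ / _) => d h0 h1; apply/andP; split; lra.
Qed.

(** * Averaging over the classes of compositions that fix all but two parts *)

Section Pair.
Variables (n r : nat) (p q : 'I_r).
Hypothesis p_neq_q : p != q.
Implicit Types (k : {ffun 'I_r -> 'I_n.+1}).

Definition pair_sum k : nat := k p + k q.

(** The splitting of the total of the parts [p] and [q] that gives [j] to [p]. *)
Definition resplit k (j : nat) : {ffun 'I_r -> 'I_n.+1} :=
  [ffun i => if i == p then inord j else
             if i == q then inord (pair_sum k - j) else k i].

Lemma prod_pair (R : comNzRingType) (f : 'I_r -> nat -> R) k :
  \prod_i f i (k i) =
  f p (k p) * f q (k q) * \prod_(i | (i != p) && (i != q)) f i (k i).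
Proof.
by rewrite (bigD1 p) //= (bigD1 q) 1?eq_sym //= mulrA.
Qed.

Lemma comp_sum_pair k :
  (\sum_i k i = pair_sum k + \sum_(i | (i != p) && (i != q)) k i)%N.
Proof. by rewrite (bigD1 p) //= (bigD1 q) 1?eq_sym //= addnA. Qed.

Lemma pair_sum_le k : k \in compositions n r -> (pair_sum k <= n)%N.
Proof.
by rewrite inE comp_sum_pair => /eqP kn; rewrite -[leqRHS]kn leq_addr.
Qed.

Section Resplit.
Variables (k : {ffun 'I_r -> 'I_n.+1}) (j : nat).
Hypotheses (k_comp : k \in compositions n r) (j_le : (j <= pair_sum k)%N).

Lemma resplit_l : resplit k j p = j :> nat.
Proof. by rewrite ffunE eqxx inordK // ltnS (leq_trans j_le) ?pair_sum_le. Qed.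

Lemma resplit_r : resplit k j q = (pair_sum k - j)%N :> nat.
Proof.
rewrite ffunE eq_sym (negPf p_neq_q) eqxx inordK // ltnS.
by rewrite (leq_trans (leq_subr _ _)) ?pair_sum_le.
Qed.

Lemma resplit_out i : (i != p) && (i != q) -> resplit k j i = k i.
Proof. by move=> /andP[/negPf ip /negPf iq]; rewrite ffunE ip iq. Qed.

Lemma pair_sum_resplit : pair_sum (resplit k j) = pair_sum k.
Proof. by rewrite /pair_sum resplit_l resplit_r subnKC. Qed.

Lemma resplit_comp : resplit k j \in compositions n r.
Proof.
move: (k_comp); rewrite !inE !comp_sum_pair pair_sum_resplit.
rewrite [X in (_ + X)%N == _ -> _](eq_bigr (fun i => resplit k j i : nat)) //.
by move=> i /resplit_out ->.
Qed.

Lemma rest_resplit (R : comNzRingType) (f : 'I_r -> nat -> R) :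
  \prod_(i | (i != p) && (i != q)) f i (resplit k j i) =
  \prod_(i | (i != p) && (i != q)) f i (k i).
Proof. by apply: eq_bigr => i /resplit_out ->. Qed.

Lemma prod_resplit (R : comNzRingType) (f : 'I_r -> nat -> R) :
  \prod_i f i (resplit k j i) = f p j * f q (pair_sum k - j)%N *
    \prod_(i | (i != p) && (i != q)) f i (k i).
Proof. by rewrite prod_pair resplit_l resplit_r rest_resplit. Qed.

End Resplit.

Definition same_rest k k' :=
  [forall i, (i != p) && (i != q) ==> (k i == k' i)].

Lemma same_restC k k' : same_rest k k' = same_rest k' k.
Proof. by apply: eq_forallb => i; rewrite [k i == _]eq_sym. Qed.

Lemma same_rest_sum k k' : k \in compositions n r -> k' \in compositions n r ->
  same_rest k k' -> pair_sum k = pair_sum k'.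
Proof.
rewrite !inE => /eqP kn /eqP k'n /forallP kk'.
have : (\sum_i k i = \sum_i k' i)%N by rewrite kn k'n.
rewrite !comp_sum_pair [X in (_ + X)%N = _ -> _](eq_bigr (fun i => k' i : nat)).
  by move=> /addIn.
by move=> i ip; move: (kk' i); rewrite ip /= => /eqP ->.
Qed.

Lemma sum_class (V : nmodType) (F : {ffun 'I_r -> 'I_n.+1} -> V) k :
    k \in compositions n r ->
  \sum_(k' in compositions n r | same_rest k k') F k' =
  \sum_(j < (pair_sum k).+1) F (resplit k j).
Proof.
move=> k_comp.
have resplitK k' : k' \in compositions n r -> same_rest k k' ->
    resplit k (k' p) = k' /\ (k' p <= pair_sum k)%N.
  move=> k'_comp kk'.
  have le : (k' p <= pair_sum k)%N.
    by rewrite (same_rest_sum k_comp k'_comp kk') leq_addr.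
  split=> //; apply/ffunP => i; apply/val_inj.
  have [->|ip] := eqVneq i p; first by rewrite /= resplit_l.
  have [->|iq] := eqVneq i q.
    rewrite /= resplit_r // (same_rest_sum k_comp k'_comp kk') /pair_sum.
    by rewrite addKn.
  rewrite resplit_out ?ip ?iq //.
  by move/forallP/(_ i): kk'; rewrite ip iq /= => /eqP->.
rewrite (reindex_onto (fun j : 'I_(pair_sum k).+1 => resplit k j)
   (fun k' => inord (k' p))); last first.
  by move=> k' /andP[h1 h2]; have [e le] := resplitK _ h1 h2; rewrite inordK.
apply: eq_bigl => j.
have jm : (j <= pair_sum k)%N by rewrite -ltnS.
rewrite resplit_comp //=; apply/andP; split.
  by apply/forallP => i; apply/implyP => h; rewrite resplit_out.
by apply/eqP/val_inj; rewrite /= inordK resplit_l.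
Qed.

(** The class of [k] has k p + k q + 1 members, and being in the same class is
symmetric: exchanging the two summations turns the class averages back into the
plain sum. *)
Lemma sum_pair_average (R : realFieldType) (F : {ffun 'I_r -> 'I_n.+1} -> R) :
  \sum_(k in compositions n r) F k =
  \sum_(k in compositions n r)
     (pair_sum k).+1%:R^-1 * \sum_(j < (pair_sum k).+1) F (resplit k j).
Proof.
transitivity (\sum_(k in compositions n r) \sum_(k' in compositions n r)
    if same_rest k k' then (pair_sum k).+1%:R^-1 * F k' else 0); last first.
  by apply: eq_bigr => k kc; rewrite -big_mkcondr -mulr_sumr sum_class.
rewrite exchange_big /=; apply: eq_bigr => k kc.
rewrite -big_mkcondr /=.
rewrite (eq_bigr (fun=> (pair_sum k).+1%:R^-1 * F k)); last first.
  by move=> k' /andP[k'c kk']; rewrite (same_rest_sum k'c kc kk').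
under eq_bigl do rewrite same_restC.
rewrite sum_class // sumr_const card_ord -mulrnAl -[_ *+ _]mulr_natr.
by rewrite mulVf ?mul1r ?pnatr_eq0.
Qed.

End Pair.

(** * The defect and its smoothing in two coordinates *)

Definition weight (R : realType) n r (w : nat -> R) (k : {ffun 'I_r -> 'I_n.+1}) : R :=
  \prod_(i < r) w (k i).

Definition defect (R : realType) (n r : nat) (w : nat -> R) (c : R) (x : 'I_r -> R) : R :=
  \sum_(k in compositions n r) (c - weight w k) * x_monomial x k.

Section Smoothing.
Variables (R : realType) (n r : nat) (w : nat -> R) (p q : 'I_r).
Hypothesis w_ge0 : forall j, 0 <= w j.
Hypothesis w_logconcave : logconcave w.
Hypothesis p_neq_q : p != q.
Implicit Types (k : {ffun 'I_r -> 'I_n.+1}) (x : 'I_r -> R).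

(** The mean of s^m for s between [a] and [b]; this form of it also makes sense
for a = b. *)
Definition segment_moment (a b : R) m : R :=
  m.+1%:R^-1 * \sum_(j < m.+1) a ^+ j * b ^+ (m - j).

Lemma segment_momentE a b m :
  (a - b) * segment_moment a b m = m.+1%:R^-1 * (a ^+ m.+1 - b ^+ m.+1).
Proof.
rewrite /segment_moment subrXX mulrCA; congr (_ * (_ * _)).
rewrite -(rev_sum _ (fun j => a ^+ j * b ^+ (m - j))).
by apply: eq_bigr => j _; rewrite subKn -1?ltnS.
Qed.

Definition rest_monomial x k : R :=
  \prod_(i < r | (i != p) && (i != q)) x i ^+ k i.

(** The average of the monomials over the class of [k], see [sum_smoothed]. *)
Definition smoothed_monomial x k : R :=
  rest_monomial x k * segment_moment (x p) (x q) (pair_sum p q k).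

Lemma smoothed_resplit x k j :
    k \in compositions n r -> (j <= pair_sum p q k)%N ->
  smoothed_monomial x (resplit p q k j) = smoothed_monomial x k.
Proof.
move=> k_comp jm; rewrite /smoothed_monomial pair_sum_resplit //; congr (_ * _).
exact: (rest_resplit p q k j (fun i e => x i ^+ e)).
Qed.

Lemma sum_smoothed x :
  \sum_(k in compositions n r) x_monomial x k =
  \sum_(k in compositions n r) smoothed_monomial x k.
Proof.
rewrite (sum_pair_average p_neq_q); apply: eq_bigr => k k_comp.
rewrite /smoothed_monomial /segment_moment [RHS]mulrCA; congr (_ * _).
rewrite mulr_sumr; apply: eq_bigr => j _; rewrite mulrC.
have jm : (j <= pair_sum p q k)%N by rewrite -ltnS.
exact: (prod_resplit p_neq_q k_comp jm (fun i e => x i ^+ e)).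
Qed.

(** Class by class this is [split_chebyshev], multiplied by the common factor of
the parts other than [p] and [q]. *)
Lemma sum_weight_smoothed x : (forall i, 0 <= x i) ->
  \sum_(k in compositions n r) weight w k * x_monomial x k <=
  \sum_(k in compositions n r) weight w k * smoothed_monomial x k.
Proof.
move=> x_ge0; rewrite !(sum_pair_average p_neq_q (fun k => weight w k * _)).
apply: ler_sum => k k_comp; apply: ler_wpM2l; first by rewrite invr_ge0.
set m := pair_sum p q k.
pose wrest := \prod_(i < r | (i != p) && (i != q)) w (k i).
have weightE j : (j <= m)%N -> weight w (resplit p q k j) = w j * w (m - j)%N * wrest.
  by move=> jm; exact: (prod_resplit p_neq_q k_comp jm (fun=> w)).
have monoE j : (j <= m)%N ->
    x_monomial x (resplit p q k j) = x p ^+ j * x q ^+ (m - j)%N * rest_monomial x k.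
  by move=> jm; exact: (prod_resplit p_neq_q k_comp jm (fun i e => x i ^+ e)).
have rest_ge0 : 0 <= wrest * rest_monomial x k.
  by rewrite mulr_ge0 ?prodr_ge0 // => i _; rewrite exprn_ge0.
rewrite (eq_bigr (fun j : 'I_m.+1 => wrest * rest_monomial x k *
   ((w j * w (m - j)%N) * (x p ^+ j * x q ^+ (m - j)%N)))); last first.
  by move=> j _; rewrite weightE -1?ltnS // monoE -1?ltnS //; ring.
rewrite -mulr_sumr.
rewrite [leRHS](eq_bigr (fun j : 'I_m.+1 => wrest * rest_monomial x k *
   segment_moment (x p) (x q) m * (w j * w (m - j)%N))); last first.
  move=> j _; rewrite weightE -1?ltnS // smoothed_resplit -1?ltnS //.
  by rewrite /smoothed_monomial -/m; ring.
rewrite -mulr_sumr -[leRHS]mulrA; apply: ler_wpM2l => //.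
rewrite /segment_moment mulrAC -mulrA ler_pdivlMl ?ltr0n //.
exact: split_chebyshev.
Qed.

Lemma defect_ge_smoothed c x : (forall i, 0 <= x i) ->
  \sum_(k in compositions n r) (c - weight w k) * smoothed_monomial x k <=
  defect n w c x.
Proof.
move=> x_ge0; rewrite /defect.
under eq_bigr do rewrite mulrBl.
under [leRHS]eq_bigr do rewrite mulrBl.
rewrite !sumrB -!mulr_sumr sum_smoothed lerD2l lerN2.
exact: sum_weight_smoothed.
Qed.

Definition merge_coords x (s : R) : 'I_r -> R :=
  fun i => if (i == p) || (i == q) then s else x i.

(** A primitive of s |-> defect at the vector with both coordinates set to s. *)
Definition merge_primitive c x : {poly R} :=
  \sum_(k in compositions n r) ((c - weight w k) * rest_monomial x k
     * (pair_sum p q k).+1%:R^-1) *: 'X^((pair_sum p q k).+1).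

Lemma horner_merge_primitive_deriv c x s :
  ((merge_primitive c x)^`()).[s] = defect n w c (merge_coords x s).
Proof.
rewrite raddf_sum horner_sum; apply: eq_bigr => k _ /=.
rewrite derivZ derivXn hornerZ hornerMn hornerXn /= -[s ^+ _ *+ _]mulr_natr.
rewrite /x_monomial (prod_pair p_neq_q (fun i e => merge_coords x s i ^+ e)).
rewrite /merge_coords !eqxx orbT -exprD.
rewrite (_ : \prod_(i < r | _) _ = rest_monomial x k); last first.
  by apply: eq_bigr => i /andP[/negPf-> /negPf->].
rewrite -/(pair_sum p q k).
have : (pair_sum p q k).+1%:R != 0 :> R by rewrite pnatr_eq0.
by move: (_.+1%:R) => M M0; field.
Qed.

(** The smoothed defect is the mean of the defect over the segment between the
two coordinates. *)
Lemma merge_primitive_increment c x :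
  (merge_primitive c x).[x p] - (merge_primitive c x).[x q] =
  (x p - x q) * \sum_(k in compositions n r) (c - weight w k) * smoothed_monomial x k.
Proof.
rewrite !horner_sum -sumrB mulr_sumr; apply: eq_bigr => k _.
rewrite !hornerZ !hornerXn /smoothed_monomial.
rewrite [RHS](_ : _ = (c - weight w k) * rest_monomial x k *
  ((x p - x q) * segment_moment (x p) (x q) (pair_sum p q k))); last by ring.
by rewrite segment_momentE; ring.
Qed.

(** The mean over the segment is at most the minimum, so [poly_eq_of_mean_le]
makes the defect constant along the merged vectors; its value at s = x q is the
one wanted. *)
Lemma merge_minimizer c x M :
    (forall i, 0 <= x i <= M) ->
    (forall z : 'I_r -> R, (forall i, 0 <= z i <= M) -> defect n w c x <= defect n w c z) ->
  defect n w c (merge_coords x (x q)) = defect n w c x.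
Proof.
move=> x_cube x_min.
have x_ge0 i : 0 <= x i by have /andP[] := x_cube i.
set P := merge_primitive c x.
have P_min lo hi : 0 <= lo -> hi <= M -> forall s, lo <= s <= hi ->
    defect n w c x <= (P^`()).[s].
  move=> lo0 hiM s /andP[los shi]; rewrite horner_merge_primitive_deriv.
  apply: x_min => i; rewrite /merge_coords; case: ifP => // _.
  by rewrite (le_trans lo0 los) (le_trans shi hiM).
have [x_le_M xq_le_M] : x p <= M /\ x q <= M.
  by have /andP[_ ->] := x_cube p; have /andP[_ ->] := x_cube q.
have Pinc := merge_primitive_increment c x.
have smooth_le := defect_ge_smoothed c x_ge0.
rewrite -horner_merge_primitive_deriv -/P.
have [pq|qp|pq] := ltrgtP (x p) (x q).
- rewrite (poly_eq_of_mean_le pq (P_min _ _ (x_ge0 p) xq_le_M)) ?hornerC //.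
  rewrite -opprB Pinc -mulNr opprB mulrC ler_wpM2r // subr_ge0; exact: ltW.
- rewrite (poly_eq_of_mean_le qp (P_min _ _ (x_ge0 q) x_le_M)) ?hornerC //.
  rewrite Pinc mulrC ler_wpM2r // subr_ge0; exact: ltW.
- rewrite horner_merge_primitive_deriv; congr defect; apply/funext => i.
  by rewrite /merge_coords; have [->|_] := eqVneq i p; [|have [->|] := eqVneq i q].
Qed.

End Smoothing.

(** * The minimum of the defect over a cube *)

Lemma continuous_defect (R : realType) n r (w : nat -> R) c :
  continuous (fun v : 'rV[R]_r => defect n w c (v ord0)).
Proof.
have add_cont : continuous (fun t : R * R => t.1 + t.2) by move=> t; exact: add_continuous.
have mul_cont : continuous (fun t : R * R => t.1 * t.2) by move=> t; exact: mul_continuous.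
have coord_cont (k : {ffun 'I_r -> 'I_n.+1}) i :
    continuous (fun v : 'rV[R]_r => v ord0 i ^+ k i).
  move=> v.
  apply: (@continuous_comp _ _ _ (fun v : 'rV[R]_r => v ord0 i) (fun t => t ^+ k i)).
    exact: coord_continuous.
  exact: exprn_continuous.
have monomial_cont (k : {ffun 'I_r -> 'I_n.+1}) :
    continuous (fun v : 'rV[R]_r => x_monomial (v ord0) k).
  exact: (@continuous_big R _ _ 1 xpredT mul_cont _ _ _ (fun i _ => coord_cont k i)).
have term_cont (k : {ffun 'I_r -> 'I_n.+1}) :
    continuous (fun v : 'rV[R]_r => (c - weight w k) * x_monomial (v ord0) k).
  move=> v; apply: continuous_comp; first exact: monomial_cont.
  exact: mulrl_continuous.
exact: (@continuous_big R _ _ 0 (mem (compositions n r)) add_cont _ _ _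
  (fun k _ => term_cont k)).
Qed.

Lemma defect_minimizer (R : realType) n r (w : nat -> R) c (M : R) : 0 <= M ->
  exists2 x : 'I_r -> R, (forall i, 0 <= x i <= M) &
    forall z : 'I_r -> R, (forall i, 0 <= z i <= M) -> defect n w c x <= defect n w c z.
Proof.
move=> M_ge0.
pose A := [set v : 'rV[R]_r | forall i, `[0, M]%classic (v ord0 i)]%classic.
have A_compact : compact A.
  by apply: (@rV_compact R r (fun=> `[0, M]%classic)) => i; exact: segment_compact.
have A_neq0 : (A !=set0)%classic by exists 0 => i /=; rewrite mxE in_itv /= lexx.
have [v vA v_min] := EVT_min_rV A_neq0 A_compact
  (continuous_subspaceT (@continuous_defect R n r w c)).
exists (v ord0) => [i|z z_cube].
  by move: vA; rewrite inE => /(_ i); rewrite /= in_itv.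
have -> : defect n w c z = defect n w c ((\row_i z i) ord0).
  by congr defect; apply/funext => i; rewrite mxE.
by apply: v_min; rewrite inE => i /=; rewrite mxE in_itv /=.
Qed.

Lemma defect_const (R : realType) n r (w : nat -> R) c v :
  defect n w c (fun _ : 'I_r => v) =
  v ^+ n * (#|compositions n r|%:R * c - \sum_(k in compositions n r) weight w k).
Proof.
rewrite /defect (eq_bigr (fun k => v ^+ n * (c - weight w k))).
  by rewrite -mulr_sumr sumrB sumr_const mulr_natl.
by move=> k; rewrite inE => /eqP kn; rewrite mulrC /x_monomial -expr_sum kn.
Qed.

(** Merging every coordinate in turn with coordinate [q] keeps the vector
minimal. *)
Lemma defect_min_const (R : realType) n r (w : nat -> R) c (M : R)
    (x : 'I_r -> R) (q : 'I_r) :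
    (forall j, 0 <= w j) -> logconcave w ->
    (forall i, 0 <= x i <= M) ->
    (forall z : 'I_r -> R, (forall i, 0 <= z i <= M) -> defect n w c x <= defect n w c z) ->
  defect n w c (fun _ : 'I_r => x q) = defect n w c x.
Proof.
move=> w_ge0 w_lc x_cube x_min.
pose y (s : seq 'I_r) i := if i \in s then x q else x i.
have y_cube s i : 0 <= y s i <= M by rewrite /y; case: ifP.
have yq s : y s q = x q by rewrite /y; case: ifP.
suff y_min s : defect n w c (y s) = defect n w c x.
  rewrite -(y_min (enum 'I_r)); congr defect; apply/funext => i.
  by rewrite /y mem_enum.
elim: s => [|p s IHs]; first by congr defect.
have [->|p_neq_q] := eqVneq p q.
  rewrite -IHs; congr defect; apply/funext => i.
  by rewrite /y inE; have [->|] := eqVneq i q => //=; rewrite if_same.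
rewrite -IHs -(merge_minimizer w_ge0 w_lc p_neq_q (y_cube s)); last first.
  by move=> z z_cube; rewrite IHs; exact: x_min.
congr defect; apply/funext => i; rewrite /merge_coords yq /y inE.
have [//|_] := eqVneq i p; have [->|//] := eqVneq i q.
by rewrite /= if_same.
Qed.

(** The smallest value of the defect over a cube containing [x] is attained at a
constant vector, where it is 0 once [c] is the mean weight. *)
Theorem logconcave_correlation (R : realType) (n r : nat) (w : nat -> R) (x : 'I_r -> R) :
    (forall j, 0 <= w j) -> logconcave w ->
    (forall i, 0 <= x i) -> (0 < r)%N ->
  #|compositions n r|%:R * \sum_(k in compositions n r) weight w k * x_monomial x k <=
  (\sum_(k in compositions n r) weight w k) * \sum_(k in compositions n r) x_monomial x k.
Proof.
move=> w_ge0 w_lc x_ge0 r_gt0; pose q := Ordinal r_gt0.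
have [K0|K_neq0] := eqVneq #|compositions n r| 0%N.
  rewrite K0 mul0r (eq_bigl _ _ (card0_eq K0)) big_pred0_eq mul0r //.
pose N : R := #|compositions n r|%:R.
have N_gt0 : 0 < N by rewrite ltr0n lt0n.
set W := \sum_(k in _) weight w k.
have M_ge0 : 0 <= \sum_i x i by exact: sumr_ge0.
have [z z_cube z_min] := @defect_minimizer R n r w (W / N) _ M_ge0.
have z_defect : defect n w (W / N) z = 0.
  rewrite -(defect_min_const q w_ge0 w_lc z_cube z_min) defect_const -/W -/N.
  by rewrite mulrCA mulfV ?gt_eqF // mulr1 subrr mulr0.
have x_cube i : 0 <= x i <= \sum_i x i.
  by rewrite x_ge0 (bigD1 i) //= lerDl sumr_ge0.
have := z_min x x_cube; rewrite z_defect /defect.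
under eq_bigr do rewrite mulrBl.
by rewrite sumrB -mulr_sumr subr_ge0 mulrAC ler_pdivlMr // mulrC.
Qed.

Theorem mainTheorem5 (R : realType) (n r l : nat) (x : 'I_r -> R)
    (n_ge1 : (1 <= n)%N) (r_ge1 : (1 <= r)%N)
    (x_gt0 : forall i : 'I_r, 0 < x i) :
  1 / #|compositions n r|%:R
    * (\sum_(k in compositions n r) y_coef R l k)
    * (\sum_(k in compositions n r) x_monomial x k)
  >= \sum_(k in compositions n r) y_coef R l k * x_monomial x k.
Proof.
pose w j : R := 1 / ((j + l)`!)%:R.
have fact_gt0 j : 0 < ((j + l)`!)%:R :> R by rewrite ltr0n fact_gt0.
have w_ge0 j : 0 <= w j by rewrite divr_ge0 // ltW.
have w_lc : logconcave w.
  (* After clearing denominators this is i + l + 1 <= j + l + 1. *)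
  move=> i j ij; rewrite /w !div1r -!invfM lef_pV2 ?posrE ?mulr_gt0 //.
  rewrite -!natrM ler_nat !addSn !factS -mulnA mulnCA [X in (_ <= X)%N]mulnCA.
  by rewrite mulnCA leq_mul2r ltnS leq_add2r ij orbT.
have key := logconcave_correlation n w_ge0 w_lc (fun i => ltW (x_gt0 i)) r_ge1.
have [K0|K_neq0] := eqVneq #|compositions n r| 0%N.
  by rewrite !(eq_bigl _ _ (card0_eq K0)) !big_pred0_eq !mulr0.
(* The coefficient of k is the weight of k for w, by conversion. *)
by rewrite div1r -mulrA ler_pdivlMl ?ltr0n ?lt0n.
Qed.
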